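(* Let $\mathcal{H}$ be a finite set of graphs. If the class of $\mathcal{H}$-free graphs is intersectionwise $\chi$-guarding, then $\mathcal{H}$ contains a forest, $\mathcal{H}$ contains the line graph of a forest, $\mathcal{H}$ contains a complete multipartite graph, and $\mathcal{H}$ contains a trivially perfect graph.
   Context: All graphs are finite and simple. A graph is $\mathcal{H}$-free if it has no induced subgraph isomorphic to a member of $\mathcal{H}$. The line graph $L(G)$ has vertex set $E(G)$, two edges adjacent iff they share an endpoint. A graph is complete multipartite if its vertex set can be partitioned into nonempty independent sets pairwise complete to each other. A graph $G$ is trivially perfect if for every induced subgraph $H$ of $G$ the independence number of $H$ equals the number of maximal cliques of $H$. The graph-intersection of classes $\mathcal{A},\mathcal{B}$ is the class of all graphs $(V(G)\cap V(H),E(G)\cap E(H))$ with $G\in\mathcal{A}$, $H\in\mathcal{B}$. A class is $\chi$-bounded if there is a non-decreasing $f:\mathbb{N}\to\mathbb{N}$ with $\chi(G)\le f(\omega(G))$ for all members. A class $\mathcal{A}$ is intersectionwise $\chi$-guarding if for every $\chi$-bounded class $\mathcal{B}$ the graph-intersection of $\mathcal{A}$ and $\mathcal{B}$ is $\chi$-bounded. *)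

(* Defs.v *)
From HB Require Import structures.
From mathcomp Require Import all_boot finmap.

Set Implicit Arguments.
Unset Strict Implicit.
Unset Printing Implicit Defensive.

Local Open Scope fset_scope.

(* Vertices are named by elements of a choiceType T, so that two graphs on T
   can be intersected literally.  The null graph is allowed, since it can arise
   as an intersection. *)
Section Graph.
Variable T : choiceType.

Definition wf_graph (p : {fset T} * {fset {fset T}}) : bool :=
  all (fun e => (e `<=` p.1) && (#|` e| == 2)) p.2.

Record sgraph : Type := SGraph
  { gval : {fset T} * {fset {fset T}}; gvalP : wf_graph gval }.

HB.instance Definition _ := [isSub for gval].
HB.instance Definition _ := [Choice of sgraph by <:].

Definition vset (G : sgraph) : {fset T} := (gval G).1.
Definition eset (G : sgraph) : {fset {fset T}} := (gval G).2.

Definition adj (G : sgraph) : rel (vset G) :=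
  fun x y => [fset val x; val y] \in eset G.

Lemma esetP (G : sgraph) (e : {fset T}) :
  e \in eset G -> (e `<=` vset G) && (#|` e| == 2).
Proof. exact: (allP (gvalP G)). Qed.

Lemma induced_wf (G : sgraph) (S : {fset T}) :
  wf_graph (vset G `&` S, [fset e in eset G | e `<=` S]).
Proof.
apply/allP => e; rewrite !inE /= => /andP[/esetP/andP[eV e2] eS].
by rewrite fsubsetI eV eS.
Qed.
Definition induced (G : sgraph) (S : {fset T}) : sgraph :=
  SGraph (induced_wf G S).

Lemma graph_inter_wf (G H : sgraph) :
  wf_graph (vset G `&` vset H, eset G `&` eset H).
Proof.
apply/allP => e; rewrite !inE /= => /andP[/esetP/andP[eG e2] /esetP/andP[eH _]].
by rewrite fsubsetI eG eH.
Qed.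
Definition graph_inter (G H : sgraph) : sgraph := SGraph (graph_inter_wf G H).

Definition clique (G : sgraph) (A : {set vset G}) : bool :=
  [forall x in A, forall y in A, (x != y) ==> adj x y].

Definition stable (G : sgraph) (A : {set vset G}) : bool :=
  [forall x in A, forall y in A, ~~ adj x y].

Definition omega (G : sgraph) : nat :=
  \max_(A : {set vset G} | clique A) #|A|.

Definition alpha (G : sgraph) : nat :=
  \max_(A : {set vset G} | stable A) #|A|.

(* Maximal cliques are required to be nonempty, which only matters for the
   null graph: it has none, and so has as many as its independence number. *)
Definition max_cliques (G : sgraph) : {set {set vset G}} :=
  [set A | (A != set0) && maxset (@clique G) A].

Definition colorable (G : sgraph) (k : nat) : bool :=
  [exists c : {ffun vset G -> 'I_k},
     [forall x, forall y, adj x y ==> (c x != c y)]].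

Lemma adj_irr (G : sgraph) (x : vset G) : adj x x = false.
Proof.
by apply/negP => /esetP/andP[_]; rewrite fsetUid cardfs1.
Qed.

Lemma colorable_ex (G : sgraph) : exists k, colorable G k.
Proof.
exists #|{: vset G}|; apply/existsP; exists [ffun x => enum_rank x].
apply/forallP => x; apply/forallP => y; apply/implyP; rewrite !ffunE.
by apply: contraTneq => /enum_rank_inj ->; rewrite adj_irr.
Qed.
Definition chi (G : sgraph) : nat := ex_minn (colorable_ex G).

Definition forest (G : sgraph) : Prop :=
  forall s : seq (vset G), 2 < size s -> uniq s -> ~~ cycle (@adj G) s.

Definition complete_multipartite (G : sgraph) : Prop :=
  exists P : {set {set vset G}},
    [/\ partition P [set: vset G],
        forall A, A \in P -> stable A
      & forall A B, A \in P -> B \in P -> A != B ->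
          forall x y, x \in A -> y \in B -> adj x y].

Definition trivially_perfect (G : sgraph) : Prop :=
  forall S : {fset T}, S `<=` vset G ->
    alpha (induced G S) = #|max_cliques (induced G S)|.

End Graph.

Lemma line_graph_wf (T : choiceType) (G : sgraph T) :
  wf_graph (eset G,
    [fset [fset e; f] | e in eset G, f in eset G
                      & (e != f) && (e `&` f != fset0)]).
Proof.
apply/allP => p /imfset2P[e /= eE [f]]; rewrite !inE /=.
case/andP=> fE /andP[ef _] ->.
by rewrite fsubUset !fsub1set eE fE cardfs2 ef.
Qed.
Definition line_graph (T : choiceType) (G : sgraph T) : sgraph {fset T} :=
  SGraph (line_graph_wf G).

Definition iso (T U : choiceType) (G : sgraph T) (H : sgraph U) : Prop :=
  exists2 f : vset G -> vset H, bijective f & {mono f : x y / adj x y}.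

(* Classes consist of graphs with vertex names in nat, an infinite supply, so
   every finite graph has a copy there.  They need not be closed under
   isomorphism; the class of F-free graphs is, and intersecting such a class
   with B or with the isomorphism closure of B gives the same graphs up to
   isomorphism. *)
Definition gclass : Type := sgraph nat -> Prop.

Definition free (F : {fset sgraph nat}) : gclass := fun G =>
  ~ exists H S, [/\ H \in F, S `<=` vset G & iso H (induced G S)].

Definition class_inter (A B : gclass) : gclass := fun K =>
  exists G H, [/\ A G, B H & K = graph_inter G H].

Definition chi_bounded (A : gclass) : Prop :=
  exists2 f : nat -> nat, {homo f : m n / m <= n}
    & forall G, A G -> chi G <= f (omega G).

Definition intersectionwise_chi_guarding (A : gclass) : Prop :=
  forall B : gclass, chi_bounded B -> chi_bounded (class_inter A B).

(* Main.v *)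
(** The class of graphs with [chi <= omega] is chi-bounded but not hereditary.
    Suppose that [free F] contains, for arbitrarily large [k], a graph having a
    stable set of N vertices and, on the N other vertices, a triangle-free
    subgraph R that is not k-colourable.  Adding to R a disjoint clique on the
    stable set gives a graph with [chi <= omega], and intersecting the two graphs
    leaves R and N isolated vertices, so [free F] is not guarding.

    If F contains no forest, this applies to R together with isolated vertices,
    where R has girth larger than the order of every member of F.  Every R is also
    a subgraph of a clique K_N, so F must have a member that is an induced subgraph
    of K_N with N isolated vertices, and one that is an induced subgraph of K_N
    joined to a stable set of size N.  The former is a disjoint union of cliques,
    hence trivially perfect and the line graph of a star forest; the latter is
    complete multipartite.

    Graphs R of large girth and chromatic number come from Erdos' random graph
    G(n, 1/q) with n a constant multiple d of q, on which the number of short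
    cycles is at most a constant on average.  The vertices deleted in the usual
    argument are kept here as isolated vertices. *)
Require Import Defs.
From Stdlib Require Import Classical_Prop.
From mathcomp Require Import all_boot finmap zify.
Set Implicit Arguments.
Unset Strict Implicit.
Unset Printing Implicit Defensive.

(** * Counting preliminaries *)

(** The values of a random function are independent, so it maps [D] into [B] with probability
    (|B|/|V|)^|D|; denominators are cleared to stay in [nat]. *)
Lemma card_constrained_ffun (P V : finType) (D : {set P}) (B : {pred V}) :
  #|[set f : {ffun P -> V} | [forall p in D, f p \in B]]| * #|V| ^ #|D| =
  #|B| ^ #|D| * #|V| ^ #|P|.
Proof.
pose F p : pred V := if p \in D then [in B] else predT.
have -> : #|[set f : {ffun P -> V} | [forall p in D, f p \in B]]| = #|family F|.
  apply: eq_card => f; rewrite inE; apply/forall_inP/familyP => [H p | H p pD].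
    by rewrite /F; case: ifP => [/H // | _]; rewrite inE.
  by have := H p; rewrite /F pD.
rewrite card_family foldrE big_map big_enum /= (bigID [in D]) /=.
rewrite (eq_bigr (fun=> #|B|)); last by move=> p pD; rewrite /F pD; apply: eq_card.
rewrite [X in _ * X * _](eq_bigr (fun=> #|V|)); last first.
  by move=> p pD; rewrite /F (negPf pD); apply: eq_card.
rewrite !prod_nat_const -mulnA -expnD; congr (_ * _ ^ _).
rewrite -(cardC D) addnC; congr (_ + _).
Qed.

(** Serves twice: the edges of a cycle are pairwise distinct, and a vertex of degree one lies on no
    cycle. *)
Lemma next_next_neq (T : eqType) (s : seq T) (x : T) :
  uniq s -> 2 < size s -> x \in s -> next s (next s x) != x.
Proof.
move=> Us s2 xs; have [i s' Es] := rot_to xs.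
rewrite -!(next_rot i Us) Es.
have := s2; rewrite -(size_rot i) Es; case: s' Es => [|a [|b s']] // Es _.
have := Us; rewrite -(rot_uniq i) Es /= !inE => /andP[xN _]; rewrite eqxx.
rewrite !negb_or in xN; case/and3P: xN => xa xb _.
by rewrite [a == x]eq_sym (negPf xa) eqxx eq_sym.
Qed.

Lemma bernoulli_half q : 2 * q ^ q.+1 <= q.+1 ^ q.+1.
Proof.
case: q => // q.
(* Bernoulli's inequality (1 + 1/(q+1))^m >= 1 + m/(q+1), cleared of denominators and used at m = q
   + 2. *)
suff H m : q.+1 ^ m * (q.+1 + m) <= q.+2 ^ m * q.+1.
  have := H q.+2; rewrite addnS -addSn; set a := _ ^ _; set b := _ ^ _ => Hm.
  rewrite -(leq_pmul2r (ltn0Sn q)); apply: leq_trans Hm.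
  by rewrite mulnC mulnA [_ * a]mulnC leq_mul2l; apply/orP; right; lia.
elim: m => [|m IH]; first by rewrite addn0.
rewrite !expnS; apply: (@leq_trans (q.+2 * (q.+1 ^ m * (q.+1 + m)))).
  by rewrite -mulnA mulnCA [leqRHS]mulnCA leq_mul2l; apply/orP; right; nia.
by rewrite -mulnA leq_mul2l IH orbT.
Qed.

(** * The random graph with edge probability 1/(q+1) *)

Section RandomGraph.
Variables n q : nat.
Notation pairs := ('I_n * 'I_n)%type.
Notation sample := {ffun pairs -> 'I_q.+1}.

Definition ordered_pair (x y : 'I_n) : pairs := if x < y then (x, y) else (y, x).

(** Only the values on increasing pairs are ever read. The remaining coordinates are kept so that
    the sample space is a plain function space with independent values. *)
Definition sample_adj (f : sample) : rel 'I_n :=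
  fun x y => (x != y) && (f (ordered_pair x y) == ord0).

Lemma ordered_pairC x y : ordered_pair x y = ordered_pair y x.
Proof. by rewrite /ordered_pair; case: ltngtP => // /val_inj ->. Qed.

Lemma ordered_pair_inj x y u v :
  ordered_pair x y = ordered_pair u v -> (x = u /\ y = v) \/ (x = v /\ y = u).
Proof. by rewrite /ordered_pair; case: ifP => _; case: ifP => _ [-> ->]; auto. Qed.

Lemma sample_adj_sym f : symmetric (sample_adj f).
Proof. by move=> x y; rewrite /sample_adj eq_sym ordered_pairC. Qed.

(** The cycle fixes the value of [f] at [size s] distinct coordinates, so it occurs with probability
    at most (q+1)^-(size s). *)
Lemma card_cycle_samples (s : seq 'I_n) : uniq s -> 2 < size s ->
  #|[set f | cycle (sample_adj f) s]| * q.+1 ^ size s <= q.+1 ^ #|{: pairs}|.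
Proof.
move=> Us s2; pose D := [set ordered_pair x (next s x) | x in s].
have cardD : #|D| = size s.
  rewrite card_in_imset; first exact/card_uniqP.
  move=> x y xs ys /ordered_pair_inj[[] // | [-> xy]].
  by have /negP[] := next_next_neq Us s2 ys; rewrite xy.
have := card_constrained_ffun D (pred1 (ord0 : 'I_q.+1)).
rewrite card1 exp1n mul1n card_ord cardD => <-.
rewrite leq_mul2r; apply/orP; right; apply: subset_leq_card.
apply/subsetP => f; rewrite !inE => fs; apply/forall_inP => p /imsetP[x xs ->].
by have /andP[_] := next_cycle fs xs.
Qed.

(** Cycle lengths run from 3 to g + 2. Every rotation of a cycle is again such a tuple, so the heads
    exhaust its vertices. *)
Definition cycle_vertices (g : nat) (f : sample) : {set 'I_n} :=
  \bigcup_(i < g) [set thead s | s in [set s : (i.+3).-tuple 'I_n |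
                                  uniq s && cycle (sample_adj f) s]].

(** There are n^l tuples of length l, each a cycle with probability at most (q+1)^-l, so the mean
    number of cycles is at most d^l, whatever [q] is. *)
Lemma sum_cycle_vertices d g : n = d * q.+1 ->
  \sum_f #|cycle_vertices g f| <= (\sum_(i < g) d ^ i.+3) * q.+1 ^ #|{: pairs}|.
Proof.
move=> nE.
pose C (i : nat) f := [set s : (i.+3).-tuple 'I_n | uniq s && cycle (sample_adj f) s].
apply: (@leq_trans (\sum_f \sum_(i < g) #|C i f|)).
  apply: leq_sum => f _; rewrite /cycle_vertices.
  elim/big_rec2: _ => [|i m A _ IH]; first by rewrite cards0.
  apply: leq_trans (leq_card_setU _ _) _; rewrite leq_add //.
  exact: leq_imset_card.
rewrite exchange_big big_distrl /=; apply: leq_sum => i _.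
rewrite -(leq_pmul2r (expn_gt0 q.+1 i.+3 : 0 < q.+1 ^ i.+3)).
(* Double counting of the pairs of a sample and a cyclic tuple in it. *)
have -> : \sum_f #|C i f| =
          \sum_(s : (i.+3).-tuple 'I_n | uniq s) #|[set f | cycle (sample_adj f) s]|.
  rewrite (eq_bigr (fun f => \sum_(s : (i.+3).-tuple 'I_n | uniq s) (cycle (sample_adj f) s : nat))).
    rewrite exchange_big /=; apply: eq_bigr => s _.
    by rewrite -sum1dep_card [RHS]big_mkcond; apply: eq_bigr => f _; case: cycle.
  by move=> f _; rewrite -sum1dep_card big_mkcondr; apply: eq_bigr => s _; case: cycle.
rewrite big_distrl /=.
apply: (@leq_trans (\sum_(s : (i.+3).-tuple 'I_n) q.+1 ^ #|{: pairs}|)).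
  rewrite [leqLHS]big_mkcond; apply: leq_sum => s _; case: ifP => // Us.
  by have := card_cycle_samples Us; rewrite size_tuple; apply.
rewrite sum_nat_const card_tuple card_ord {1}nE expnMn.
by rewrite mulnAC.
Qed.

Definition ordered_pairs (A : {set 'I_n}) : {set pairs} :=
  [set p | [&& p.1 \in A, p.2 \in A & p.1 < p.2]].

Lemma card_ordered_pairs (A : {set 'I_n}) : #|A| * #|A| = 2 * #|ordered_pairs A| + #|A|.
Proof.
rewrite -cardsX -(cardsID (ordered_pairs A) (setX A A)).
have -> : setX A A :&: ordered_pairs A = ordered_pairs A.
  apply/setP => -[x y]; rewrite !inE /=.
  by case: (x \in A); case: (y \in A); rewrite ?andbF.
rewrite mul2n -addnn -addnA; congr (_ + _).
rewrite -(cardsID [set p : pairs | p.2 < p.1] (_ :\: _)); congr (_ + _).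
  have swapI : injective (fun p : pairs => (p.2, p.1)) by move=> [x y] [u v] [-> ->].
  rewrite -[RHS](card_imset _ swapI); apply: eq_card => -[x y].
  apply/idP/imsetP => [|[[u v]]]; rewrite !inE /=; last first.
    by move=> H [-> ->]; lia.
  by move=> H; exists (y, x) => //; rewrite !inE /=; lia.
have diagI : injective (fun x : 'I_n => (x, x)) by move=> x y [].
rewrite -[RHS](card_imset _ diagI); apply: eq_card => -[x y].
apply/idP/imsetP => [|[u uA [-> ->]]]; rewrite !inE /=; last by rewrite uA ltnn.
move=> H; have xy : x = y by apply: val_inj; move: H => /=; lia.
by exists x; rewrite ?xy //; move: H; rewrite xy; lia.
Qed.

(** Stability forbids the value 0 on every increasing pair of [A]. By [bernoulli_half], each batch
    of q + 1 pairs contributes a factor of at most 1/2. *)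
Lemma card_stable_samples (A : {set 'I_n}) t : q.+1 * t <= #|ordered_pairs A| ->
  #|[set f | [forall x in A, forall y in A, ~~ sample_adj f x y]]| * 2 ^ t
    <= q.+1 ^ #|{: pairs}|.
Proof.
move=> tm; set m := #|_| in tm.
have E : q ^ m * 2 ^ t <= q.+1 ^ m.
  rewrite -(subnK tm) (expnD q) (expnD q.+1) -mulnA leq_mul //.
    by case: (_ - _) => // k; rewrite leq_exp2r.
  rewrite (expnM q q.+1) (expnM q.+1 q.+1) -expnMn.
  by case: (t) => // k; rewrite leq_exp2r // mulnC bernoulli_half.
have := card_constrained_ffun (ordered_pairs A) (predC1 (ord0 : 'I_q.+1)).
rewrite cardC1 card_ord /= -/m.
set X := #|[set _ | _]|; set Y := #|[set _ | _]| => HX.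
have YX : Y <= X.
  apply: subset_leq_card; apply/subsetP => f; rewrite !inE => /forall_inP H.
  apply/forall_inP => -[x y]; rewrite inE /= => /and3P[xA yA xy].
  have /forall_inP/(_ y yA) := H x xA.
  by rewrite /sample_adj /ordered_pair xy negb_and negbK -val_eqE /= (ltn_eqF xy).
rewrite -(leq_pmul2r (expn_gt0 q.+1 m : 0 < q.+1 ^ m)).
apply: (@leq_trans (X * q.+1 ^ m * 2 ^ t)).
  by rewrite mulnAC leq_mul2r leq_mul2r YX !orbT.
by rewrite HX mulnAC mulnC leq_mul2l E orbT.
Qed.

End RandomGraph.

(** * Graphs of large girth and chromatic number *)

Lemma high_girth_high_chromatic g k :
  exists n (e : rel 'I_n),
  [/\ symmetric e, irreflexive e,
      forall s, 2 < size s -> size s <= g -> uniq s -> ~~ cycle e s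
    & forall c : 'I_n -> 'I_k.+1, exists x y, e x y /\ c x = c y].
Proof.
(* [b] is large enough for every set of [a = n / (2 (k + 1))] vertices to span at
   least [(q + 1) (n + 2)] pairs, which beats the [2 ^ n] choices of the set. *)
pose b := 4 * k.+1 + 2; pose d := 2 * k.+1 * b.
(* [C] bounds the mean size of [cycle_vertices] and depends only on [d] and [g], so [q] can be
   chosen afterwards to make 8 * C < n. Markov's inequality then bounds the probability of [bad1] by
   1/4. *)
pose C := \sum_(i < g) d ^ i.+3; pose q := 4 * C + 1.
pose a := b * q.+1.
have [n nd nE] : exists2 n, n = d * q.+1 & n = 2 * k.+1 * a.
  by exists (d * q.+1); rewrite // /d /a; lia.
pose M := #|{: 'I_n * 'I_n}|.
pose bad1 := [set f | n < 2 * #|cycle_vertices g f|] : {set {ffun 'I_n * 'I_n -> 'I_q.+1}}.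
pose stab (A : {set 'I_n}) :=
  [set f : {ffun 'I_n * 'I_n -> 'I_q.+1}
     | [forall x in A, forall y in A, ~~ sample_adj f x y]].
pose bad2 := \bigcup_(A : {set 'I_n} | a <= #|A|) stab A.
have Mgt0 : 0 < q.+1 ^ M by rewrite expn_gt0.
have n_gt : 8 * C < n by rewrite nd /d /b /q; nia.
have small1 : 4 * #|bad1| <= q.+1 ^ M.
  have H : #|bad1| * n <= 2 * (C * q.+1 ^ M).
    apply: (@leq_trans (2 * \sum_f #|cycle_vertices g (f : {ffun 'I_n * 'I_n -> 'I_q.+1})|)).
      rewrite -sum_nat_const big_distrr /= big_mkcond /=.
      by apply: leq_sum => f _; rewrite inE; case: ifP => // /ltnW.
    by rewrite leq_mul2l (sum_cycle_vertices _ nd) orbT.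
  have n0 : 0 < n by lia.
  rewrite -(leq_pmul2r n0) -mulnA.
  apply: (@leq_trans (4 * (2 * (C * q.+1 ^ M)))); first by rewrite leq_mul2l H orbT.
  by rewrite !mulnA [X in _ <= X]mulnC leq_mul2r; apply/orP; right; lia.
have small2 : 4 * #|bad2| <= q.+1 ^ M.
  rewrite -(leq_pmul2r (expn_gt0 2 n : 0 < 2 ^ n)).
  (* Union bound over at most 2^n sets, each stable with probability at most 2^-(n+2); the extra 2
     in the exponent yields the 1/4. *)
  have -> : 4 * #|bad2| * 2 ^ n = #|bad2| * 2 ^ n.+2 by rewrite !expnS; lia.
  apply: (@leq_trans ((\sum_(A : {set 'I_n} | a <= #|A|) #|stab A|) * 2 ^ n.+2)).
    rewrite leq_mul2r; apply/orP; right; rewrite /bad2.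
    elim/big_rec2: _ => [|A m B _ IH]; first by rewrite cards0.
    by apply: leq_trans (leq_card_setU _ _) _; rewrite leq_add.
  rewrite big_distrl /= mulnC.
  apply: (@leq_trans (\sum_(A : {set 'I_n}) q.+1 ^ M)); last first.
    by rewrite sum_nat_const -cardsT -powersetT card_powerset cardsT card_ord.
  rewrite big_mkcond /=; apply: leq_sum => A _; case: ifP => // aA.
  apply: card_stable_samples; have := card_ordered_pairs A.
  set m := #|ordered_pairs A|; set s := #|A| in aA * => ms.
  have : a * (a - 1) <= 2 * m by nia.
  have ab : b <= a by rewrite leq_pmulr.
  have b6 : 6 <= b by rewrite /b; lia.
  have ba : b * a = 2 * n + 2 * a by rewrite nE mulnA -mulnDl; congr (_ * _); rewrite /b; lia.
  have aa : a * (a - 1) = q.+1 * (b * (a - 1)) by rewrite {1}/a mulnAC mulnC.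
  have : q.+1 * (2 * n.+2) <= q.+1 * (b * (a - 1)).
    by rewrite leq_mul2l mulnBr muln1 ba; apply/orP; right; lia.
  by rewrite -aa mulnCA; lia.
have [f fgood] : exists f, f \notin bad1 :|: bad2.
  apply/existsP; rewrite -negb_forall; apply/negP => /forallP H.
  have : q.+1 ^ M <= #|bad1| + #|bad2|.
    apply: leq_trans (leq_card_setU _ _).
    have -> : bad1 :|: bad2 = setT by apply/setP => f; rewrite H inE.
    by rewrite cardsT card_ffun card_ord.
  by lia.
move: fgood; rewrite inE negb_or inE -leqNgt => /andP[fD fstab].
set D := cycle_vertices g f in fD.
exists n, (fun x y => [&& x \notin D, y \notin D & sample_adj f x y]); split.
- by move=> x y; rewrite sample_adj_sym; case: (x \in D); case: (y \in D).
- by move=> x; rewrite /sample_adj eqxx !andbF.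
- move=> s s2 sg Us; apply/negP => es.
  case: s => // x s in s2 sg Us es *.
  (* The head has an edge, so it is outside [D]; yet as the head of a short cycle of the sample it
     is in [D]. *)
  have /and3P[xD _ _] := next_cycle es (mem_head x s); move/negP: xD; apply.
  have [i si] : exists i, size (x :: s) == i.+3.
    by exists (size (x :: s)).-2.-1; move: s2; case: s {sg Us es} => [|? []].
  have ig : i < g by move: sg; rewrite (eqP si); lia.
  apply/bigcupP; exists (Ordinal ig) => //=.
  apply/imsetP; exists (Tuple si); last by rewrite /thead (tnth_nth x).
  rewrite inE Us /=; move: es; apply: sub_path.
  by move=> u v /and3P[].
(* Pigeonhole: at least n/2 = (k + 1) a vertices lie outside [D], so one of the k + 1 colours occurs
   there [a] times, and that class is not stable. *)
- move=> c; have [j aj] : exists j, a <= #|[set v in ~: D | c v == j]|.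
    apply/existsP; rewrite -[X in is_true X]negbK negb_exists; apply/negP => /forallP H.
    have : #|~: D| <= \sum_(j < k.+1) (a - 1).
      rewrite -sum1_card (partition_big c predT) //=; apply: leq_sum => j _.
      have := H j; rewrite -ltnNge -sum1dep_card => Hj.
      by move: Hj; case: (a) => // m; rewrite subn1.
    rewrite sum_nat_const card_ord; have := cardsC D; rewrite card_ord.
    have a0 : 0 < k.+1 * a by rewrite muln_gt0 /a /b; lia.
    move: nE fD; rewrite mulnBr muln1 -mulnA; move: a0; set P := k.+1 * a.
    by move: #|D| #|~: D| => u v; lia.
  set A := [set _ in _ | _] in aj.
  have /forall_inPn[x xA /forall_inPn[y yA]] : ~~ [forall x in A, forall y in A, ~~ sample_adj f x y].
    apply: contra fstab => H; apply/bigcupP; exists A => //.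
    by rewrite inE.
  rewrite negbK => xy; exists x, y.
  move: xA yA; rewrite !inE => /andP[-> /eqP->] /andP[-> /eqP->].
  by rewrite xy.
Qed.

(** As a relation on [nat], the graph can be placed in any larger vertex set, its further vertices
    being isolated. *)
Lemma high_girth_high_chromatic_nat g k :
  exists N (r : rel nat),
  [/\ symmetric r, irreflexive r, forall x y, r x y -> x < N,
      forall s, 2 < size s -> size s <= g -> uniq s -> ~~ cycle r s
    & forall c : nat -> 'I_k.+1, exists x y, r x y /\ c x = c y].
Proof.
have [n [e [e_sym e_irr e_cycle e_col]]] := high_girth_high_chromatic g k.
pose r x y := [exists i : 'I_n, exists j : 'I_n, [&& val i == x, val j == y & e i j]].
have rP x y : reflect (exists i j : 'I_n, [/\ val i = x, val j = y & e i j]) (r x y).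
  apply: (iffP existsP) => [[i /existsP[j /and3P[/eqP ? /eqP ? ?]]] | [i [j [? ? ij]]]].
    by exists i, j.
  by exists i; apply/existsP; exists j; rewrite ij; apply/and3P; split=> //; apply/eqP.
have re (i j : 'I_n) : r (val i) (val j) = e i j.
  by apply/rP/idP => [[i' [j' [/val_inj-> /val_inj-> //]]] | ij]; exists i, j.
have r_sym x y : r x y -> r y x.
  by case/rP => i [j [<- <- ij]]; rewrite re e_sym.
exists n, r; split.
- by move=> x y; apply/idP/idP; apply: r_sym.
- by move=> x; apply/rP => -[i [j [<- /val_inj->]]]; rewrite e_irr.
- by move=> x y /rP[i [j [<- _ _]]]; apply: ltn_ord.
- move=> s s2 sg Us; apply/negP => rs.
  have sn x : x \in s -> x < n.
    by move=> /(next_cycle rs) /rP[i [j [<- _ _]]]; apply: ltn_ord.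
  have [s' Es] : exists s' : seq 'I_n, s = map val s'.
    elim: s sn {s2 sg Us rs} => [|x s IH] sn; first by exists [::].
    have [|s' ->] := IH; first by move=> y ys; rewrite sn // inE ys orbT.
    by exists (Ordinal (sn x (mem_head x s)) :: s').
  move: s2 sg Us rs; rewrite Es size_map cycle_map (map_inj_uniq val_inj) => s2 sg Us.
  by rewrite (eq_cycle re) (negPf (e_cycle _ s2 sg Us)).
- move=> c; have [i [j [ij cij]]] := e_col (c \o val).
  by exists (val i), (val j); rewrite re.
Qed.

(** * Graphs given by a relation on an initial segment of [nat] *)

Section Graphs.
Local Open Scope fset_scope.

Lemma fset2_eq (T : choiceType) (x y a b : T) :
  [fset x; y] = [fset a; b] -> (x = a /\ y = b) \/ (x = b /\ y = a).
Proof.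
move=> /fsetP E; have := E x; have := E y; have := E a; have := E b.
rewrite !inE !eqxx /= !orbT => + + /esym + /esym +.
by do 4!(case/orP=> /eqP ?); subst; auto.
Qed.

Section RelGraph.
Variables (N : nat) (r : rel nat).
Hypotheses (r_sym : symmetric r) (r_irr : irreflexive r).

Definition rel_vset : {fset nat} := [fset x in iota 0 N].

Lemma rel_graph_wf :
  wf_graph (rel_vset,
    [fset [fset x; y] | x in rel_vset, y in rel_vset & (x != y) && r x y]).
Proof.
apply/allP => p /imfset2P[x /= xV [y]]; rewrite !inE /= => /and3P[yV xy _] ->.
by rewrite !inE /= in xV; rewrite fsubUset !fsub1set !inE xV yV cardfs2 xy.
Qed.
Definition rel_graph : sgraph nat := SGraph rel_graph_wf.

Lemma in_rel_vset x : (x \in vset rel_graph) = (x < N).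
Proof. by rewrite /vset /= !inE mem_iota. Qed.

Lemma rel_graph_edge x y :
  ([fset x; y] \in eset rel_graph) = [&& x < N, y < N & r x y].
Proof.
rewrite /eset /=; apply/imfset2P/and3P => [[a /= aV [b]]|[xN yN xy]].
  rewrite !inE /= in aV *; move: aV; rewrite !mem_iota /= => aN /and3P[bN _ ab].
  by case/fset2_eq => -[-> ->]; rewrite aN bN // r_sym.
have xNy : x != y by apply: contraTneq xy => ->; rewrite r_irr.
exists x; first by rewrite /= !inE mem_iota.
by exists y; rewrite //= ?inE /= mem_iota yN xNy.
Qed.

Lemma rel_graph_adj (x y : vset rel_graph) : adj x y = r (val x) (val y).
Proof.
have := valP x; have := valP y; rewrite !in_rel_vset => yN xN.
by rewrite /adj rel_graph_edge xN yN.
Qed.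

Lemma rel_graph_induced_adj (S : {fset nat}) (x y : vset (induced rel_graph S)) :
  adj x y = r (val x) (val y).
Proof.
have := valP x; have := valP y.
rewrite {1 3}/vset /= !in_fsetI -/(vset rel_graph) !in_rel_vset.
move=> /andP[yN yS] /andP[xN xS].
rewrite /adj /eset /= !inE /= -/(eset rel_graph) rel_graph_edge xN yN /=.
by rewrite fsubUset !fsub1set xS yS !andbT.
Qed.

End RelGraph.

(** An equality and not just an isomorphism, as [class_inter] demands. *)
Lemma eq_rel_graph N (r1 r2 r3 : rel nat) :
  symmetric r1 -> irreflexive r1 -> symmetric r2 -> irreflexive r2 ->
  symmetric r3 -> irreflexive r3 -> (forall x y, r1 x y && r2 x y = r3 x y) ->
  graph_inter (rel_graph N r1) (rel_graph N r2) = rel_graph N r3.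
Proof.
move=> s1 i1 s2 i2 s3 i3 E; apply: val_inj.
rewrite /= /graph_inter /= {1 2}/vset /= fsetIid; congr pair.
apply/fsetP => e; rewrite in_fsetI -/(eset (rel_graph N r3)).
apply/andP/idP => [[e1 e2]|e3].
  have /imfset2P[x xV [y yV Exy]] := e1.
  move: e1 e2; rewrite Exy !rel_graph_edge // => /and3P[-> -> r1xy] /and3P[_ _ r2xy].
  by rewrite -E r1xy r2xy.
have /imfset2P[x xV [y yV Exy]] := e3.
move: e3; rewrite Exy !rel_graph_edge // -E => /and3P[-> -> /andP[-> ->]].
by [].
Qed.

Lemma chi_leq (T : choiceType) (G : sgraph T) k : colorable G k -> chi G <= k.
Proof. by rewrite /chi; case: ex_minnP => m _; apply. Qed.

Lemma colorable_chi (T : choiceType) (G : sgraph T) : colorable G (chi G).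
Proof. by rewrite /chi; case: ex_minnP. Qed.

Lemma colorableP (T : choiceType) (G : sgraph T) k :
  reflect (exists c : vset G -> 'I_k, forall x y, adj x y -> c x != c y) (colorable G k).
Proof.
apply: (iffP existsP) => [[c /forallP H]|[c H]].
  by exists c => x y; move/forallP: (H x) => /(_ y) /implyP.
exists (finfun c); apply/forallP => x; apply/forallP => y; apply/implyP.
by rewrite !ffunE; apply: H.
Qed.

(** * A criterion for not being guarding *)

Lemma not_guarding (A : gclass) :
  (forall k, exists N (r q : rel nat),
     [/\ [/\ symmetric r, irreflexive r, forall x y, r x y -> x < N,
            forall x y z, r x y -> r y z -> r z x -> False
          & forall c : nat -> 'I_k.+1, exists x y, r x y /\ c x = c y],
        symmetric q, irreflexive q, forall x y, r x y -> q x y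
      & (forall x y, N <= x -> N <= y -> ~~ q x y) /\ A (rel_graph (N + N) q)]) ->
  ~ intersectionwise_chi_guarding A.
Proof.
move=> HA guard; have [|f f_mono fP] := guard (fun G => chi G <= omega G).
  by exists id.
(* The intersection will be triangle-free, so the supposed bound on its chromatic number is
   [f 2]. *)
have [N [r [q [[r_sym r_irr rN r_tri r_col] q_sym q_irr rq [qN Aq]]]]] := HA (f 2).
pose h x y := r x y || [&& x != y, N <= x & N <= y].
have h_sym : symmetric h.
  by move=> x y; rewrite /h r_sym eq_sym; congr (_ || (_ && _)); apply: andbC.
have h_irr : irreflexive h by move=> x; rewrite /h r_irr eqxx.
pose G := rel_graph (N + N) q; pose H := rel_graph (N + N) h.
pose K := rel_graph (N + N) r.
have KE : graph_inter G H = K.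
  apply: eq_rel_graph => // x y; rewrite /h; case rxy: (r x y).
    by rewrite (rq _ _ rxy).
  apply/negP => /andP[qxy /and3P[_ Nx Ny]].
  by have := qN _ _ Nx Ny; rewrite qxy.
have NH : chi H <= N.
  apply: chi_leq; apply/colorableP.
  case: (posnP N) => [N0|N0].
    suff F (x : vset H) : False by exists (fun x => False_rect _ (F x)) => x; case: (F x).
    by have := valP x; rewrite in_rel_vset N0.
  (* Reduction modulo N is injective on each half of the vertices, and [h] has no edge between the
     halves. *)
  exists (fun x => Ordinal (ltn_pmod (val x) N0)) => x y.
  rewrite rel_graph_adj // -val_eqE /=.
  have := valP x; have := valP y; rewrite !in_rel_vset => yN xN.
  have modE z : z < N + N -> z %% N = if z < N then z else z - N.
    case: (ltnP z N) => [zN _|zN zNN]; first by rewrite modn_small.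
    by rewrite -{1}(subnK zN) modnDr modn_small //; lia.
  rewrite !modE //; case/orP=> [rxy|/and3P[xy Nx Ny]].
    rewrite (rN _ _ rxy); move: (rxy); rewrite r_sym => /rN ->.
    by apply: contraTneq rxy => ->; rewrite r_irr.
  rewrite ltnNge Nx /= ltnNge Ny /=; move: (val x) (val y) xy Nx Ny => u v uv Nu Nv.
  by apply: contra uv => /eqP uv; apply/eqP; lia.
have omegaH : N <= omega H.
  have HN (i : 'I_N) : (N + i)%N \in vset H by rewrite in_rel_vset ltn_add2l.
  pose S : {set vset H} := [set FSetSub (HN i) | i : 'I_N].
  have cS : #|S| = N.
    rewrite card_imset ?card_ord // => i j /(congr1 val) /= /addnI.
    exact: val_inj.
  rewrite -{1}cS; apply: (@leq_bigmax_cond _ _ (fun A : {set vset H} => #|A|)).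
  apply/forall_inP => x /imsetP[i _ ->]; apply/forall_inP => y /imsetP[j _ ->].
  apply/implyP; rewrite rel_graph_adj //= /h !leq_addr -val_eqE /= => ->.
  by rewrite orbT.
have omegaK : omega K <= 2.
  apply/bigmax_leqP => S /forall_inP HS; rewrite leqNgt; apply/negP.
  move=> /card_gt2P[x [y [z [[xS yS zS] [xy yz zx]]]]].
  have adjS u v : u \in S -> v \in S -> u != v -> r (val u) (val v).
    move=> uS vS uv; move/forall_inP: (HS u uS) => /(_ v vS) /implyP /(_ uv).
    by rewrite rel_graph_adj.
  by apply: (r_tri (val x) (val y) (val z)); apply: adjS.
have chiK : chi K <= f 2.
  apply: leq_trans (f_mono _ _ omegaK); apply: fP; exists G, H; split => //.
  exact: leq_trans NH omegaH.
have /colorableP[c cP] := colorable_chi K.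
have widen (i : 'I_(chi K)) : i < (f 2).+1 by rewrite ltnS (leq_trans _ chiK) // ltnW.
(* The default colour is harmless: both ends of an edge of [r] are vertices of [K]. *)
pose c' x := if insub x is Some v then Ordinal (widen (c v)) else ord0.
have [x [y [rxy]]] := r_col c'.
have xN : x \in vset K by rewrite in_rel_vset (leq_trans (rN _ _ rxy)) ?leq_addr.
have yN : y \in vset K.
  by rewrite in_rel_vset (leq_trans (rN y x _)) ?leq_addr // r_sym.
rewrite /c' (insubT (fun z => z \in vset K) xN) (insubT (fun z => z \in vset K) yN).
move=> /(congr1 val) /= /val_inj cxy.
have /cP : @adj _ K [` xN] [` yN] by rewrite rel_graph_adj.
by rewrite cxy eqxx.
Qed.

(** * Complete multipartite graphs and disjoint unions of cliques *)

Lemma iso_induced_rel_graph (H : sgraph nat) N (q : rel nat) (S : {fset nat}) :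
  symmetric q -> irreflexive q -> iso H (induced (rel_graph N q) S) ->
  exists2 f : nat -> nat, injective (fun x : vset H => f (val x))
    & forall x y : vset H, adj x y = q (f (val x)) (f (val y)).
Proof.
move=> q_sym q_irr [g /bij_inj g_inj gP].
pose f x := if insub x is Some v then val (g v) else 0.
have fE (x : vset H) : f (val x) = val (g x) by rewrite /f valK.
exists f => [x y | x y]; rewrite !fE; first by move/val_inj/g_inj.
by rewrite -gP (rel_graph_induced_adj q_sym q_irr).
Qed.

Lemma preimage_multipartite (T : choiceType) (H : sgraph T) (p : vset H -> nat) :
  (forall x y, adj x y = (p x != p y)) -> complete_multipartite H.
Proof.
move=> pP; exists (preim_partition p setT).
have partP := preim_partitionP p setT.
have same A x y : A \in preim_partition p setT -> x \in A -> y \in A -> p x = p y.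
  case/imsetP => z _ ->; rewrite !inE => /eqP <- /eqP <- //.
split=> // [A AP|A B AP BP AB x y xA yB].
  apply/forall_inP => x xA; apply/forall_inP => y yA.
  by rewrite pP (same A x y) // eqxx.
rewrite pP; apply: contra AB => /eqP pxy.
case/imsetP: AP xA => u _ ->; case/imsetP: BP yB => v _ ->.
rewrite !inE => /eqP vy /eqP ux; apply/eqP/setP => w.
by rewrite !inE vy ux pxy.
Qed.

(* [p] names the connected components of a disjoint union of cliques. *)
Definition cluster_by (T : choiceType) (H : sgraph T) (p : T -> nat) :=
  forall x y : vset H, adj x y = (x != y) && (p (val x) == p (val y)).

(** As [p] acts on names and not on vertices of [H], it serves the subgraph unchanged. *)
Lemma cluster_induced (T : choiceType) (H : sgraph T) p (S : {fset T}) :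
  cluster_by H p -> cluster_by (induced H S) p.
Proof.
move=> Hp x y; have := valP x; have := valP y.
rewrite {1 3}/vset /= !in_fsetI -/(vset H) => /andP[yV yS] /andP[xV xS].
have := Hp (FSetSub xV) (FSetSub yV).
rewrite -val_eqE /= => HV; rewrite -val_eqE /= -HV /adj.
rewrite /eset /= !inE /= -/(eset H).
by rewrite fsubUset !fsub1set xS yS !andbT.
Qed.

(** The maximal cliques are the components; a stable set meets each at most once, and choosing one
    vertex in each attains equality. *)
Lemma cluster_alpha (T : choiceType) (H : sgraph T) p :
  cluster_by H p -> alpha H = #|max_cliques H|.
Proof.
move=> Hp; pose block (x : vset H) := [set y : vset H | p (val y) == p (val x)].
have block_clique x : clique (block x).
  apply/forall_inP => y; rewrite inE => /eqP yx; apply/forall_inP => z.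
  by rewrite inE => /eqP zx; apply/implyP => yz; rewrite Hp yz yx zx /=.
have clique_block (A : {set vset H}) x : clique A -> x \in A -> A \subset block x.
  move=> /forall_inP Acl xA; apply/subsetP => y yA; rewrite inE.
  case: (eqVneq y x) => [-> //|yx].
  by move/forall_inP: (Acl y yA) => /(_ x xA) /implyP /(_ yx); rewrite Hp => /andP[].
have -> : max_cliques H = [set block x | x : vset H].
  apply/setP => A; rewrite inE; apply/andP/imsetP => [[/set0Pn[x xA] Amax]|[x _ ->]].
    have /maxsetP[Acl A_max] := Amax.
    by exists x => //; apply/esym/A_max => //; apply: clique_block.
  split; first by apply/set0Pn; exists x; rewrite inE.
  apply/maxsetP; split=> // B Bcl xB; apply/eqP; rewrite eqEsubset xB andbT.
  by apply: clique_block => //; apply: (subsetP xB); rewrite inE.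
(* A representative of the block of [x]. The default is never taken, as [x] is in its block, so
   [m x] depends on the block alone. *)
pose m x := odflt x [pick y in block x].
have mP x : p (val (m x)) = p (val x).
  by rewrite /m; case: pickP => //= y; rewrite inE => /eqP.
have m_eq x y : p (val x) = p (val y) -> m x = m y.
  move=> xy; rewrite /m (eq_pick (_ : [in block x] =1 [in block y])).
    by case: pickP => //= /(_ y); rewrite inE eqxx.
  by move=> z; rewrite !inE xy.
apply/eqP; rewrite eqn_leq; apply/andP; split.
  apply/bigmax_leqP => A /forall_inP Ast.
  rewrite -(card_in_imset (f := block) (D := A)).
    by apply: subset_leq_card; apply/subsetP => _ /imsetP[x _ ->]; apply: imset_f.
  move=> x y xA yA /setP /(_ x); rewrite !inE eqxx => /esym pxy.
  apply/eqP; apply/negP => /negP xy.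
  by move/forall_inP: (Ast x xA) => /(_ y yA); rewrite Hp xy pxy.
pose A := [set m x | x : vset H].
have stA : stable A.
  apply/forall_inP => _ /imsetP[x _ ->]; apply/forall_inP => _ /imsetP[y _ ->].
  by rewrite Hp !mP; apply/negP => /andP[/eqP mxy /eqP /m_eq].
apply: (@leq_trans #|A|); last first.
  exact: (@leq_bigmax_cond _ _ (fun A : {set vset H} => #|A|)).
have -> : [set block x | x : vset H] = block @: A.
  rewrite -imset_comp; apply: eq_imset => x; apply/setP => y.
  by rewrite !inE mP.
exact: leq_imset_card.
Qed.

Lemma cluster_trivially_perfect (T : choiceType) (H : sgraph T) p :
  cluster_by H p -> trivially_perfect H.
Proof. by move=> Hp S _; apply: (cluster_alpha (p := p)); apply: cluster_induced. Qed.

(** * Star forests and their line graphs *)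

Section StarForest.
Variables (V : {fset nat}) (p : nat -> nat).

(* Centres get even names and leaves odd ones, so that they never collide. *)
Definition star_edge (x : nat) : {fset nat} := [fset (p x).*2; x.*2.+1].

Lemma star_forest_wf :
  wf_graph ([fset (p x).*2 | x in V] `|` [fset x.*2.+1 | x in V],
            [fset star_edge x | x in V]).
Proof.
apply/allP => e /imfsetP[x /= xV ->]; rewrite fsubUset !fsub1set !inE cardfs2.
apply/andP; split; last by apply/eqP; case: eqP => //; lia.
by apply/andP; split; apply/orP; [left|right]; apply/imfsetP; exists x.
Qed.
Definition star_forest : sgraph nat := SGraph star_forest_wf.

Lemma star_forest_adjP (u v : vset star_forest) : adj u v ->
  exists x, (val u = x.*2.+1 /\ val v = (p x).*2) \/ (val v = x.*2.+1 /\ val u = (p x).*2).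
Proof.
rewrite /adj /eset /= => /imfsetP[x _ /fset2_eq[[-> ->]|[-> ->]]]; exists x; auto.
Qed.

(** A leaf has only one neighbour, so a cycle would consist of centres; but every edge has a
    leaf. *)
Lemma forest_star_forest : forest star_forest.
Proof.
move=> s s2 Us; apply/negP => sc.
have leafN z : z \in s -> ~~ odd (val z).
  move=> zs; apply/negP => z_odd.
  have leaf v : adj z v \/ adj v z -> val v = (p (val z)./2).*2.
    by case=> /star_forest_adjP[x [[Ez Ev]|[Ev Ez]]]; move: z_odd;
      rewrite ?Ev ?Ez /= ?odd_double // uphalf_double.
  have np : next s z = prev s z.
    apply: val_inj; rewrite (leaf _ (or_introl (next_cycle sc zs))).
    by rewrite -(leaf _ (or_intror (prev_cycle sc zs))).
  have := next_next_neq Us s2 (_ : prev s z \in s); rewrite mem_prev => /(_ zs).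
  by rewrite next_prev // np eqxx.
case: s s2 Us sc leafN => // x s s2 Us sc leafN.
have xs := mem_head x s; have xN := leafN _ xs.
have := leafN (next (x :: s) x); rewrite mem_next => /(_ xs) nN.
by have /star_forest_adjP[y [[E _]|[E _]]] := next_cycle sc xs;
  [move: xN | move: nN]; rewrite E /= odd_double.
Qed.

End StarForest.

(** A vertex x corresponds to the edge joining leaf x to centre p x. Distinct edges have distinct
    leaves, so they meet exactly when their centres agree. *)
Lemma cluster_line_graph (H : sgraph nat) p :
  cluster_by H p -> iso H (line_graph (star_forest (vset H) p)).
Proof.
move=> Hp; set K := star_forest _ _.
have edge_in (x : vset H) : star_edge p (val x) \in vset (line_graph K).
  by apply/imfsetP; exists (val x) => //; apply: valP.
have edge_inj : injective (star_edge p).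
  by move=> x y /fset2_eq[[_ /eqP]|[]]; [rewrite eqSS => /eqP|]; lia.
pose f x : vset (line_graph K) := FSetSub (edge_in x).
have f_inj : injective f by move=> x y /(congr1 val) /= /edge_inj /val_inj.
exists f.
  apply: inj_card_bij => //; rewrite -!cardfE.
  rewrite [X in #|` X| <= _](_ : _ = [fset star_edge p x | x in vset H]) //.
  by rewrite card_imfset.
move=> x y; rewrite Hp.
have meet (a b : nat) : a != b ->
    (star_edge p a `&` star_edge p b != fset0) = (p a == p b).
  move=> ab; apply/fset0Pn/eqP => [[z]|pab].
    rewrite !inE => /andP[/orP[]/eqP-> /orP[]/eqP]; move: ab; case: eqP => // ab _; lia.
  by exists (p a).*2; rewrite !inE pab eqxx.
rewrite /adj /= /eset /=; apply/imfset2P/andP => [[a aE [b]]|[xy pxy]].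
  rewrite !inE /= => /and3P[bE ab meet_ab] /fset2_eq E.
  have Exy : star_edge p (val x) != star_edge p (val y) by case: E ab => -[-> ->]; rewrite // eq_sym.
  have xy : val x != val y by apply: contra Exy => /eqP ->.
  split; first by rewrite -val_eqE.
  by rewrite -meet //; case: E meet_ab => -[-> ->] //; rewrite fsetIC.
exists (star_edge p (val x)); first exact: edge_in.
exists (star_edge p (val y)) => //; rewrite ?inE /=.
have vxy : val x != val y by [].
apply/and3P; split; [exact: edge_in | | by rewrite meet].
by apply: contra vxy => /eqP/edge_inj/eqP.
Qed.

(** * The members that a guarding class must forbid *)

Lemma girth_triangle_free (r : rel nat) g : symmetric r -> irreflexive r -> 2 < g ->
  (forall s, 2 < size s -> size s <= g -> uniq s -> ~~ cycle r s) ->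
  forall x y z, r x y -> r y z -> r z x -> False.
Proof.
move=> r_sym r_irr g2 r_girth x y z xy yz zx.
have neq u v : r u v -> u != v by apply: contraTneq => ->; rewrite r_irr.
apply: (negP (r_girth [:: x; y; z] isT g2 _)); last by rewrite /= xy yz zx.
by rewrite /= !inE negb_or (neq x y) // (neq y z) // eq_sym (neq z x).
Qed.

(** The clique below N contains every possible [r], so [not_guarding] applies unless some host graph
    fails to be [F]-free. Pairs across N are left open, which allows both extremes. *)
Lemma guarding_contains (F : {fset sgraph nat}) (q : nat -> rel nat) :
  (forall N, [/\ symmetric (q N), irreflexive (q N),
     forall x y, x < N -> y < N -> x != y -> q N x y
   & forall x y, N <= x -> N <= y -> ~~ q N x y]) ->
  intersectionwise_chi_guarding (free F) ->
  exists2 H, H \in F & exists N S, iso H (induced (rel_graph (N + N) (q N)) S).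
Proof.
move=> qP guard; apply: NNPP => noH; apply: not_guarding guard => k.
have [N [r [r_sym r_irr rN r_girth r_col]]] := high_girth_high_chromatic_nat 3 k.
have [q_sym q_irr q_clique q_stable] := qP N.
exists N, r, (q N); split=> //.
- by split=> //; apply: girth_triangle_free r_girth.
- move=> x y xy; apply: q_clique; [exact: rN xy | by apply: (rN y x); rewrite r_sym |].
  by apply: contraTneq xy => ->; rewrite r_irr.
- split=> // -[H [S [HF _ HS]]]; apply: noH; exists H => //.
  by exists N, S.
Qed.

Lemma guarding_contains_forest (F : {fset sgraph nat}) :
  intersectionwise_chi_guarding (free F) -> exists2 H, H \in F & forest H.
Proof.
move=> guard; apply: NNPP => noH; apply: not_guarding guard => k.
(* At least the order of every member of [F], so a cycle in a member would embed as a short cycle of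
   [r]; the 3 excludes triangles even if [F] is empty. *)
pose g := (3 + \sum_(H <- F) #|{: vset H}|)%N.
have g3 : 2 < g by [].
have [N [r [r_sym r_irr rN r_girth r_col]]] := high_girth_high_chromatic_nat g k.
exists N, r, r; split=> //.
  by split=> //; apply: girth_triangle_free g3 r_girth.
split=> [x y Nx _|[H [S [HF _ /(iso_induced_rel_graph r_sym r_irr)[f f_inj fP]]]]].
  by apply/negP => /rN; rewrite ltnNge Nx.
apply: noH; exists H => // s s2 Us; apply/negP => sc.
apply: (negP (r_girth [seq f (val x) | x <- s] _ _ _)).
- by rewrite size_map.
- rewrite size_map -(card_uniqP Us); apply: leq_trans (max_card _) _.
  by rewrite /g (big_rem H) //=; lia.
- by rewrite map_inj_uniq.
- by rewrite cycle_map; rewrite (eq_cycle (e' := @adj _ H)) // => x y; rewrite /= fP.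
Qed.

Lemma guarding_contains_cluster (F : {fset sgraph nat}) :
  intersectionwise_chi_guarding (free F) ->
  exists2 H, H \in F & exists p, cluster_by H p.
Proof.
pose q N x y := [&& x != y, x < N & y < N].
have qP N : symmetric (q N) /\ irreflexive (q N).
  by split=> [x y|x]; rewrite /q ?eqxx // eq_sym; congr (_ && _); apply: andbC.
case/(guarding_contains (q := q)) => [N|H HF [N [S]]].
  have [q_sym q_irr] := qP N; split=> // x y; first by rewrite /q => -> -> ->.
  by move=> Nx _; rewrite /q !(ltnNge x) Nx andbF.
have [q_sym q_irr] := qP N; case/(iso_induced_rel_graph q_sym q_irr) => f f_inj fP.
(* Label 0 is the clique; each isolated vertex gets a positive label of its own. *)
exists H => //; exists (fun x => if f x < N then 0 else (f x).+1) => x y.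
rewrite fP /q (inj_eq f_inj); case: eqVneq => //= /eqP xy.
have fxy : f (val x) <> f (val y) by move/f_inj.
by case: ltnP => _; case: ltnP => _ //; apply/esym/eqP => -[].
Qed.

(** Truncation at N makes each vertex below N a part by itself and merges all others into one
    part. *)
Lemma guarding_contains_multipartite (F : {fset sgraph nat}) :
  intersectionwise_chi_guarding (free F) ->
  exists2 H, H \in F & complete_multipartite H.
Proof.
pose q N x y := minn x N != minn y N.
have qP N : symmetric (q N) /\ irreflexive (q N).
  by split=> [x y|x]; rewrite /q ?eqxx // eq_sym.
case/(guarding_contains (q := q)) => [N|H HF [N [S]]].
  have [q_sym q_irr] := qP N; split=> // x y; rewrite /q.
    by move=> xN yN; rewrite !(minn_idPl (ltnW _)).
  by move=> Nx Ny; rewrite !(minn_idPr _) // eqxx.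
have [q_sym q_irr] := qP N; case/(iso_induced_rel_graph q_sym q_irr) => f f_inj fP.
exists H => //; exact: preimage_multipartite fP.
Qed.

End Graphs.

Theorem theorem4p40 (F : {fset sgraph nat}) :
  intersectionwise_chi_guarding (free F) ->
  [/\ exists2 H, H \in F & forest H,
      exists2 H, H \in F & exists2 K : sgraph nat, forest K & iso H (line_graph K),
      exists2 H, H \in F & complete_multipartite H
    & exists2 H, H \in F & trivially_perfect H].
Proof.
move=> guard; have [H HF [p Hp]] := guarding_contains_cluster guard.
split.
- exact: guarding_contains_forest.
- exists H => //; exists (star_forest (vset H) p); first exact: forest_star_forest.
  exact: cluster_line_graph.
- exact: guarding_contains_multipartite.
- by exists H => //; apply: cluster_trivially_perfect Hp.
Qed.
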